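(* Let $d\ge 2$ and let $T\in\mathbb{R}^{n_1\times\cdots\times n_d}$. Let $r_0,r_0'$ be two distinct divisors of $\operatorname{rank}(T_{\langle 1\rangle})$. Let $r$ and $r'$ denote the TR-rank vectors obtained when running the TR-SVD algorithm on $T$ with precision $\varepsilon=0$ and first rank $r_0$ and $r_0'$, respectively. Then there is no common minimal rank $r_m$ of $T$ satisfying both $r_m\le r$ and $r_m\le r'$ (elementwise).
   Context: TR-format: a TR-representation of $T\in\mathbb{R}^{n_1\times\cdots\times n_d}$ with TR-rank $(r_0,r_1,\ldots,r_{d-1},r_d)$, $r_d=r_0$ (positive integers), consists of core tensors $G_k\in\mathbb{R}^{r_{k-1}\times n_k\times r_k}$, with matrix slices $G_k(i_k)\in\mathbb{R}^{r_{k-1}\times r_k}$, such that $T(i_1,\ldots,i_d)=\operatorname{Trace}(G_1(i_1)\cdots G_d(i_d))$ for all indices. Minimal rank: a vector $r=(r_0,\ldots,r_{d-1},r_0)$ of positive integers is a minimal rank of $T$ if (i) there exists a TR-representation of $T$ with TR-rank $r$, and (ii) no other vector $r'\neq r$ that is the TR-rank of a TR-representation of $T$ satisfies $r'\le r$ elementwise in $\mathbb{R}^{d+1}$. Unfolding: $T_{\langle k\rangle}\in\mathbb{R}^{(\prod_{j\le k}n_j)\times(\prod_{j>k}n_j)}$ is the $k$-th unfolding matrix, with rows indexed by $(i_1,\ldots,i_k)$ and columns by $(i_{k+1},\ldots,i_d)$. All reshapes below use MATLAB (column-major) ordering. TR-SVD algorithm with $\varepsilon=0$ and first rank $r_0$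 (a divisor of $\operatorname{rank}(T_{\langle1\rangle})$): (1) Compute a compact SVD $T_{\langle1\rangle}=U\Sigma V^T$, where $\Sigma$ is square of size $\operatorname{rank}(T_{\langle1\rangle})$, and put $r_1:=\operatorname{rank}(\Sigma)/r_0$. (2) Reshape $U$ to size $n_1\times r_0\times r_1$ and permute its modes to obtain $G_1\in\mathbb{R}^{r_0\times n_1\times r_1}$. (3) Reshape $\Sigma V^T$ to size $r_0\times r_1\times\prod_{j=2}^d n_j$, permute its modes to obtain $C$ of size $r_1\times\prod_{j=2}^d n_j\times r_0$, and merge the index $i_d$ with the last index (of size $r_0$), so that $C$ has size $r_1\times\prod_{j=2}^{d-1}n_j\times n_dr_0$. (4) For $k=2,\ldots,d-1$: reshape $C$ into a matrix with $r_{k-1}n_k$ rows, compute a compact SVD $C=U\Sigma V^T$, set $r_k=\operatorname{rank}(\Sigma)$, let $G_k$ be $U$ reshaped to size $r_{k-1}\times n_k\times r_k$, and replace $C$ by $\Sigma V^T$. (5) Let $G_d$ be $C$ reshaped to size $r_{d-1}\times n_d\times r_0$. The TR-rank vector obtained is $(r_0,r_1,\ldots,r_{d-1},r_0)$. *)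

(* Defs.v *)
From HB Require Import structures.
From mathcomp Require Import all_boot all_order all_algebra reals.

Set Implicit Arguments.
Unset Strict Implicit.
Unset Printing Implicit Defensive.

Import Order.TTheory GRing.Theory Num.Theory.
Local Open Scope ring_scope.

(* Modes and cores are numbered from 0, so that the usual n_k and G_k
   (1 <= k <= d) are [tnth n] and [G] at k-1.  Ranks keep their usual number:
   r_k is [nth 0 r k] for 0 <= k <= d, and [G k] has size r_k x n x r_(k+1) with
   n = [tnth n k]. *)

Definition multi_index (d : nat) (n : d.-tuple nat) :=
  {dffun forall k : 'I_d, 'I_(tnth n k)}.

Definition tensor (R : realType) (d : nat) (n : d.-tuple nat) :=
  {ffun multi_index n -> R}.

Definition tensor3 (R : realType) (p q s : nat) := 'I_p -> 'I_q -> 'I_s -> R.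

(* [mxdata A] is MATLAB's A(:), the entries of A in column-major order;
   [data3] is its analogue for tensors of order 3. *)
Definition mxdata (R : realType) (m p : nat) (A : 'M[R]_(m, p)) : seq R :=
  [seq A i j | j <- enum 'I_p, i <- enum 'I_m].

Definition data3 (R : realType) (p q s : nat) (A : tensor3 R p q s) : seq R :=
  flatten [seq mxdata (\matrix_(i < p, j < q) A i j k) | k <- enum 'I_s].

(* The default value 0 of [`_] is reached only if v has fewer entries than the
   target shape; in every use below that arises from a run of the algorithm the
   two numbers agree. *)
Definition reshape2 (R : realType) (m p : nat) (v : seq R) : 'M[R]_(m, p) :=
  \matrix_(i < m, j < p) v`_(i + m * j)%N.

Definition reshape3 (R : realType) (p q s : nat) (v : seq R) : tensor3 R p q s :=
  fun i j k => v`_(i + p * (j + q * k))%N.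

Lemma ind2sub_subproof (d : nat) (n : d.-tuple nat)
    (l : 'I_(\prod_(x <- n) x)%N) (k : 'I_d) :
  ((l %/ \prod_(x <- take k n) x) %% tnth n k < tnth n k)%N.
Proof.
rewrite ltn_mod lt0n; apply/negP => /eqP nk0.
by case: l => l; rewrite (big_rem (tnth n k)) ?mem_tnth //= nk0 mul0n ltn0.
Qed.

(* The multi-index at position l of the column-major enumeration (the first
   index varies fastest). *)
Definition ind2sub (d : nat) (n : d.-tuple nat)
    (l : 'I_(\prod_(x <- n) x)%N) : multi_index n :=
  [ffun k : 'I_d => Ordinal (ind2sub_subproof l k)].

Definition tensor_data (R : realType) (d : nat) (n : d.-tuple nat)
    (T : tensor R n) : seq R :=
  [seq T (ind2sub l) | l <- enum 'I_(\prod_(x <- n) x)%N].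

Definition unfolding (R : realType) (d : nat) (n : d.-tuple nat)
    (T : tensor R n) (k : nat) :
  'M[R]_((\prod_(x <- take k n) x)%N, (\prod_(x <- drop k n) x)%N) :=
  reshape2 _ _ (tensor_data T).

Definition cores (R : realType) (d : nat) (n : d.-tuple nat)
    (r : d.+1.-tuple nat) :=
  forall k : 'I_d, tensor3 R (nth 0%N r k) (tnth n k) (nth 0%N r k.+1).

Definition core_slice (R : realType) (d : nat) (n : d.-tuple nat)
    (r : d.+1.-tuple nat) (G : cores R n r) (k : 'I_d) (ik : 'I_(tnth n k)) :
  'M[R]_(nth 0%N r k, nth 0%N r k.+1) := \matrix_(a, b) G k a ik b.

(* G_1(i_1) ... G_m(i_m) in the usual numbering, meaningful for m <= d. *)
Fixpoint core_prod (R : realType) (d : nat) (n : d.-tuple nat)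
    (r : d.+1.-tuple nat) (G : cores R n r) (i : multi_index n) (m : nat) :
  'M[R]_(nth 0%N r 0, nth 0%N r m) :=
  match m with
  | 0 => 1%:M
  | m'.+1 => core_prod G i m' *m
      (if @idP (m' < d)%N is ReflectT lt_m'd
       then core_slice G (i (Ordinal lt_m'd)) else 0)
  end.

Definition has_TR_rank (R : realType) (d : nat) (n : d.-tuple nat)
    (T : tensor R n) (r : d.+1.-tuple nat) : Prop :=
  (forall k : 'I_d.+1, (0 < tnth r k)%N) /\
  exists (rd_r0 : nth 0%N r d = nth 0%N r 0) (G : cores R n r),
    forall i : multi_index n,
      T i = \tr (castmx (erefl, rd_r0) (core_prod G i d)).

Definition rank_le (d : nat) (r r' : d.+1.-tuple nat) : Prop :=
  forall k : 'I_d.+1, (tnth r k <= tnth r' k)%N.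

Definition minimal_rank (R : realType) (d : nat) (n : d.-tuple nat)
    (T : tensor R n) (r : d.+1.-tuple nat) : Prop :=
  has_TR_rank T r /\
  forall r' : d.+1.-tuple nat, r' <> r -> has_TR_rank T r' -> ~ rank_le r' r.

(* A = U Sigma V^T with Sigma = [diag_mx s].  The singular values are not
   required to be sorted; a sorted compact SVD is a particular case. *)
Definition compact_svd (R : realType) (m q p : nat) (A : 'M[R]_(m, q))
    (U : 'M[R]_(m, p)) (s : 'rV[R]_p) (V : 'M[R]_(q, p)) : Prop :=
  [/\ p = \rank A, U^T *m U = 1%:M, V^T *m V = 1%:M,
      forall j : 'I_p, 0 < s 0 j & A = U *m diag_mx s *m V^T].

(* [TR_SVD T r0 r G]: some run of the algorithm with precision 0 and first rank
   r0 returns the ranks r and the cores G.  A run is determined by the choice of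
   the SVDs.  [C k] is the column-major content of the array C once cores
   0, ..., k-1 have been produced.  Neither merging i_d with the last index
   nor reshaping C changes that content. *)
Definition TR_SVD (R : realType) (d : nat) (n : d.-tuple nat)
    (T : tensor R n) (r0 : nat) (r : d.+1.-tuple nat) (G : cores R n r) : Prop :=
  exists C : nat -> seq R,
  [/\ nth 0%N r 0 = r0 /\ nth 0%N r d = r0,
      exists p U s V,
        [/\ @compact_svd R _ _ p (unfolding T 1) U s V,
            nth 0%N r 1 = (\rank (diag_mx s) %/ r0)%N,
            forall k : 'I_d, k = 0%N :> nat -> forall a i b,
              G k a i b = reshape3 (mxdata U) i a b &
            C 1%N = data3 (fun (b : 'I_(nth 0%N r 1))
                               (j : 'I_(\prod_(x <- drop 1 n) x)%N)
                               (a : 'I_r0) =>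
                      reshape3 (mxdata (diag_mx s *m V^T)) a b j)],
      forall k : 'I_d, (0 < k < d.-1)%N ->
        exists p U s V,
        [/\ @compact_svd R _ _ p
              (reshape2 (nth 0%N r k * tnth n k)
                        ((\prod_(x <- drop k.+1 n) x) * r0) (C k)) U s V,
            nth 0%N r k.+1 = \rank (diag_mx s),
            forall a i b, G k a i b = reshape3 (mxdata U) a i b &
            C k.+1 = mxdata (diag_mx s *m V^T)] &
      forall k : 'I_d, k = d.-1 :> nat -> forall a i b,
        G k a i b = reshape3 (C k) a i b].

Definition TR_SVD_rank (R : realType) (d : nat) (n : d.-tuple nat)
    (T : tensor R n) (r0 : nat) (r : d.+1.-tuple nat) : Prop :=
  exists G : cores R n r, TR_SVD T r0 G.

(* Main.v *)
Require Import Defs.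
From mathcomp Require Import all_boot all_order all_algebra reals.

(** Cutting the ring of cores at the bonds 0 and k writes every entry of T as
    the trace of A *m B, where A, of size r_0 x r_k, depends on the first k
    indices only, and B on the remaining ones.  Such a trace is the scalar
    product of two vectors of length r_0 * r_k, so the k-th unfolding has rank
    at most r_0 * r_k ([rank_unfolding_le]).

    With rho the rank of the first unfolding, a run of TR-SVD attains this bound
    for k = 1: it returns r_1 = rho / r_0 ([TR_SVD_rank_first_two]).  If rho > 0,
    then of two runs with different first ranks the one with the larger r_0 has
    the smaller r_1.  A TR-rank below both output vectors would therefore have a product of
    its first two ranks smaller than rho, which contradicts the bound.  If
    rho = 0, each run returns r_1 = 0, and no TR-rank, being positive, lies
    below it. *)

Set Implicit Arguments.
Unset Strict Implicit.
Unset Printing Implicit Defensive.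

Import Order.TTheory GRing.Theory Num.Theory.
Local Open Scope ring_scope.

(** The entries are scalar products of the vectors [mxvec (X i)] and
    [mxvec (Y j)^T], whose common length p * q bounds the rank. *)
Lemma mxrank_trace_le (F : fieldType) (m n p q : nat) (A : 'M[F]_(m, n))
    (X : 'I_m -> 'M[F]_(p, q)) (Y : 'I_n -> 'M[F]_(q, p)) :
  (forall i j, A i j = \tr (X i *m Y j)) -> (\rank A <= p * q)%N.
Proof.
move=> AE.
have -> : A = (\matrix_i mxvec (X i)) *m (\matrix_j mxvec (Y j)^T)^T.
  apply/matrixP=> i j; rewrite AE mxE (reindex _ (curry_mxvec_bij p q)) /=.
  transitivity (\sum_a \sum_b X i a b * Y j b a).
    by apply: eq_bigr => a _; rewrite mxE.
  rewrite pair_bigA /=; apply: eq_bigr => -[a b] _.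
  by rewrite !mxE !mxvecE mxE.
exact: mulmx_max_rank.
Qed.

Lemma castmx_mulmxr (S : pzSemiRingType) (m n p q : nat) (e : p = q)
    (A : 'M[S]_(m, n)) (B : 'M[S]_(n, p)) :
  castmx (erefl, e) (A *m B) = A *m castmx (erefl, e) B.
Proof. by case: q / e; rewrite !castmx_id. Qed.

Section CoreProducts.

Variables (R : realType) (d : nat) (n : d.-tuple nat) (r : d.+1.-tuple nat).
Variable G : cores R n r.

Lemma eq_core_prod (i i' : multi_index n) (m : nat) :
  (forall k : 'I_d, (k < m)%N -> i k = i' k) ->
  core_prod G i m = core_prod G i' m.
Proof.
elim: m => //= m IH eqi; rewrite IH => [|k ltkm]; last exact/eqi/ltnW.
by congr (_ *m _); case: {-}_ / idP => // ltmd; rewrite eqi.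
Qed.

(** The cores to the right of the bond k see only the indices k, k+1, ..., so
    one factor Y serves all multi-indices that share these with [i0]. *)
Lemma core_prod_split (i0 : multi_index n) (k m : nat) :
  (k <= m)%N ->
  exists Y : 'M[R]_(nth 0%N r k, nth 0%N r m),
    forall i : multi_index n, (forall l : 'I_d, (k <= l)%N -> i l = i0 l) ->
      core_prod G i m = core_prod G i k *m Y.
Proof.
elim: m => [|m IH] lekm.
  move: lekm; rewrite leqn0 => /eqP ->.
  by exists 1%:M => i _; rewrite mulmx1.
move: lekm; rewrite leq_eqVlt => /predU1P[-> | /[!ltnS] lekm].
  by exists 1%:M => i _; rewrite mulmx1.
have [Y YE] := IH lekm.
exists (Y *m (if @idP (m < d)%N is ReflectT ltmd
              then core_slice G (i0 (Ordinal ltmd)) else 0)) => i eqi.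
rewrite /= (YE i eqi) -mulmxA; congr (_ *m (_ *m _)).
by case: {-}_ / idP => // ltmd; rewrite eqi.
Qed.

End CoreProducts.

Section Unfoldings.

Variables (R : realType) (d : nat) (n : d.-tuple nat) (T : tensor R n).
Variable k : nat.

Notation nrows := (\prod_(x <- take k n) x)%N.
Notation ncols := (\prod_(x <- drop k n) x)%N.

Lemma unfolding_index_subproof (i : 'I_nrows) (j : 'I_ncols) :
  (i + nrows * j < \prod_(x <- n) x)%N.
Proof.
have -> : (\prod_(x <- n) x = nrows * ncols)%N.
  by rewrite -{1}(cat_take_drop k n) big_cat.
apply: (@leq_trans (nrows * j.+1)); last by rewrite leq_mul2l ltn_ord orbT.
by rewrite mulnS ltn_add2r.
Qed.

Definition unfolding_index i j : multi_index n :=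
  ind2sub (Ordinal (unfolding_index_subproof i j)).

Lemma unfoldingE i j : unfolding T k i j = T (unfolding_index i j).
Proof.
rewrite mxE /tensor_data (nth_map (Ordinal (unfolding_index_subproof i j))).
  congr (T (ind2sub _)).
  by rewrite -[X in nth _ _ X]/(val (Ordinal (unfolding_index_subproof i j)))
             nth_ord_enum.
by rewrite size_enum_ord unfolding_index_subproof.
Qed.

(** n_l divides nrows / (n_0 ... n_(l-1)) for l < k, so reducing modulo n_l
   removes the contribution of the column. *)
Lemma unfolding_index_row i j j' (l : 'I_d) :
  (l < k)%N -> unfolding_index i j l = unfolding_index i j' l.
Proof.
move=> ltlk; apply: val_inj; rewrite !ffunE /=.
have [Q QE] : exists Q, nrows = (Q * tnth n l * \prod_(x <- take l n) x)%N.
  exists (\prod_(x <- drop l.+1 (take k n)) x)%N.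
  rewrite -{1}(cat_take_drop l.+1 (take k n)) big_cat /= mulnC -mulnA.
  congr (_ * _)%N; rewrite take_takel // (take_nth 0%N) ?size_tuple //.
  by rewrite -cats1 big_cat big_seq1 (tnth_nth 0%N) mulnC.
have Pgt0 : (0 < \prod_(x <- take l n) x)%N.
  have : (0 < nrows)%N by apply: leq_ltn_trans (ltn_ord i).
  by rewrite QE muln_gt0 => /andP[].
have E (a c : nat) : ((a + nrows * c) %/ \prod_(x <- take l n) x
                      = a %/ \prod_(x <- take l n) x + c * Q * tnth n l)%N.
  by rewrite QE (mulnC _ c) !mulnA divnDMl.
by rewrite !E !(addnC (i %/ _)%N) !modnMDl.
Qed.

Lemma unfolding_index_col i i' j (l : 'I_d) :
  (k <= l)%N -> unfolding_index i j l = unfolding_index i' j l.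
Proof.
move=> lekl; apply: val_inj; rewrite !ffunE /=.
have -> : (\prod_(x <- take l n) x =
           nrows * \prod_(x <- drop k (take l n)) x)%N.
  by rewrite -{1}(cat_take_drop k (take l n)) big_cat take_takel.
have nrows_gt0 : (0 < nrows)%N by apply: leq_ltn_trans (ltn_ord i).
rewrite !divnMA !(mulnC nrows) !divnDMl //.
by rewrite (divn_small (ltn_ord i)) (divn_small (ltn_ord i')).
Qed.

(** Cutting the bonds 0 and k separates the row indices from the column
    indices, and the trace sums over the r_0 * r_k states of the two bonds. *)
Lemma rank_unfolding_le (r : d.+1.-tuple nat) :
  (k <= d)%N -> has_TR_rank T r ->
  (\rank (unfolding T k) <= nth 0%N r 0 * nth 0%N r k)%N.
Proof.
move=> lekd [_ [e [G TE]]].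
(* Without an entry there is no multi-index to split at, but the rank is 0. *)
have [nrows0 | nrows_gt0] := posnP nrows.
  by apply: leq_trans (rank_leq_row _) _; rewrite nrows0.
have [ncols0 | ncols_gt0] := posnP ncols.
  by apply: leq_trans (rank_leq_col _) _; rewrite ncols0.
pose i0 := Ordinal nrows_gt0; pose j0 := Ordinal ncols_gt0.
have [Y YE] := fin_all_exists
  (fun j => core_prod_split G (unfolding_index i0 j) lekd).
apply: (@mxrank_trace_le _ _ _ _ _ _
          (fun i => core_prod G (unfolding_index i j0) k)
          (fun j => castmx (erefl, e) (Y j))) => i j.
rewrite unfoldingE TE (YE j) => [|l lekl]; last exact: unfolding_index_col.
rewrite castmx_mulmxr; congr (\tr (_ *m _)).
by apply: eq_core_prod => l ltlk; apply: unfolding_index_row.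
Qed.

End Unfoldings.

Lemma rank_diag_mx_unit (F : fieldType) (p : nat) (s : 'rV[F]_p) :
  (forall j, s 0 j != 0) -> \rank (diag_mx s) = p.
Proof.
move=> s_neq0; apply: mxrank_unit; rewrite unitmxE det_diag unitfE.
by apply/prodf_neq0 => j _.
Qed.

(** The singular values are positive, so rank Sigma, from which r_1 is
    computed, is the rank of the unfolding itself. *)
Lemma TR_SVD_rank_first_two (R : realType) (d : nat) (n : d.-tuple nat)
    (T : tensor R n) (r0 : nat) (r : d.+1.-tuple nat) :
  TR_SVD_rank T r0 r ->
  nth 0%N r 0 = r0 /\ nth 0%N r 1 = (\rank (unfolding T 1) %/ r0)%N.
Proof.
move=> [G [C [[-> _] [p [U [s [V [[pE _ _ s_gt0 _] -> _ _]]]]] _ _]]].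
by rewrite rank_diag_mx_unit -?pE // => j; rewrite lt0r_neq0.
Qed.

Theorem proposition2p2 (R : realType) (d : nat) (n : d.-tuple nat)
    (T : tensor R n) (r0 r0' : nat) (r r' : d.+1.-tuple nat) :
  (2 <= d)%N ->
  (r0 %| \rank (unfolding T 1))%N ->
  (r0' %| \rank (unfolding T 1))%N ->
  r0 <> r0' ->
  TR_SVD_rank T r0 r ->
  TR_SVD_rank T r0' r' ->
  ~ exists rm : d.+1.-tuple nat,
      [/\ minimal_rank T rm, rank_le rm r & rank_le rm r'].
Proof.
move=> d_ge2 dvd dvd' neq svd svd' [rm [[TRrm _] le le']].
wlog lt : r0 r0' r r' dvd dvd' {neq} svd svd' le le' / (r0 < r0')%N.
  by move=> H; case: (ltngtP r0 r0') neq => // [lt|lt] _;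
     [apply: (H r0 r0' r r') | apply: (H r0' r0 r' r)].
have lt1d : (1 < d.+1)%N by apply: ltnW.
have nthE (s : d.+1.-tuple nat) : nth 0%N s 1 = tnth s (Ordinal lt1d).
  by rewrite (tnth_nth 0%N).
have rank_le_rm := rank_unfolding_le (ltnW d_ge2) TRrm.
have rm1_gt0 : (0 < nth 0%N rm 1)%N by rewrite nthE; case: TRrm.
have [r0E _] := TR_SVD_rank_first_two svd.
have [_ r1'E] := TR_SVD_rank_first_two svd'.
have rm0_le : (nth 0%N rm 0 <= r0)%N.
  by move: (le ord0); rewrite !(tnth_nth 0%N) r0E.
have rm1_le : (nth 0%N rm 1 <= \rank (unfolding T 1) %/ r0')%N.
  by rewrite -r1'E !nthE.
suff : (\rank (unfolding T 1) < \rank (unfolding T 1))%N by rewrite ltnn.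
apply: leq_ltn_trans (leq_trans rank_le_rm (leq_mul rm0_le rm1_le)) _.
(* With r_1' = rho %/ r0', this is r0 * r_1' < r0' * r_1'. *)
rewrite -{2}(divnK dvd') mulnC ltn_mul2l lt andbT.
exact: leq_trans rm1_le.
Qed.
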